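(* Let $(X,T)$ be a topological dynamical system satisfying the specification property, and let $\mathcal{F}=\{f_n\}_{n\ge1}$ be an asymptotically additive potential on $X$. Let $\Phi=\{\varphi_n\}_{n\ge1}$ be an asymptotically additive potential on $X$ with $\eta(\Phi)<\beta(\Phi)$. Then $$\beta(\mathcal{F})=\sup_{x\in\widehat{X}_\Phi}\limsup_{n\to\infty}\frac1n f_n(x)=\sup\Big\{\mathcal{F}_*(\mu):\mu\in\bigcup_{x\in\widehat{X}_\Phi}\mathcal{V}(x)\Big\}.$$
   Context: $X$ is a compact metric space with metric $d$ and $T:X\to X$ is continuous. $\mathcal{M}_T$ denotes the set of $T$-invariant Borel probability measures on $X$. For $f\in C(X)$, $S_nf=\sum_{i=0}^{n-1}f\circ T^i$. A sequence $\mathcal{F}=\{f_n\}_{n\ge1}\subset C(X)$ is an asymptotically additive potential (AAP) if for every $\xi>0$ there is $f_\xi\in C(X)$ with $\limsup_{n\to\infty}\frac1n\|f_n-S_nf_\xi\|_\infty<\xi$; for $\mu\in\mathcal{M}_T$, $\mathcal{F}_*(\mu)=\lim_{n\to\infty}\frac1n\int f_n\,d\mu$ (this limit exists). $\beta(\mathcal{F})=\max_{\mu\in\mathcal{M}_T}\mathcal{F}_*(\mu)$, $\eta(\Phi)=\min_{\mu\in\mathcal{M}_T}\Phi_*(\mu)$. The irregular set is $\widehat{X}_\Phi=\{x\in X:\lim_{n\to\infty}\frac1n\varphi_n(x)\text{ does not exist}\}$. For $x\in X$, $\mathcal{V}(x)$ is the set of weak$^*$ limit points of $\delta_{x,n}=\frac1n\sum_{i=0}^{n-1}\delta_{T^ix}$.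 $(X,T)$ has the specification property if for every $\epsilon>0$ there is an integer $m(\epsilon)$ such that for any finite collection of intervals $[a_j,b_j]\subset\mathbb{N}$, $j=1,\dots,k$, with $a_{j+1}-b_j\ge m(\epsilon)$ for $j=1,\dots,k-1$, and any $x_1,\dots,x_k\in X$, there is $x\in X$ with $d(T^{p+a_j}x,T^px_j)<\epsilon$ for all $p=0,1,\dots,b_j-a_j$ and all $j$. *)

(* Defs.v *)
From HB Require Import structures.
From mathcomp Require Import all_boot all_order all_algebra.
From mathcomp Require Import all_classical all_reals all_analysis.
Import Order.TTheory GRing.Theory Num.Theory.
Import numFieldNormedType.Exports.

Set Implicit Arguments.
Unset Strict Implicit.
Unset Printing Implicit Defensive.

Local Open Scope classical_set_scope.
Local Open Scope ring_scope.

(* A metric space (with distance [mdist]) that is pointed (nonempty with a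
   chosen point); pointedness is needed for the library's generated
   sigma-algebra construction. *)
#[short(type="pmetricType")]
HB.structure Definition PointedMetric (K : numDomainType) :=
  { M of Pointed M & Metric K M }.

Section Defs.
Context {R : realType} {X : pmetricType R}.

Definition Borel := g_sigma_algebraType (@open X).

Definition birkhoff (T : X -> X) (g : X -> R) (n : nat) (x : X) : R :=
  \sum_(i < n) g (iter i T x).

Definition supnorm (h : X -> R) : R := sup [set `|h x| | x in [set: X]].

(* Asymptotically additive potential; F n is f_n for n >= 1 (F 0 unused). *)
Definition AAP (T : X -> X) (F : nat -> X -> R) : Prop :=
  (forall n, (0 < n)%N -> continuous (F n)) /\
  forall xi : R, 0 < xi -> exists g : X -> R, continuous g /\
    (limn_esup (fun n : nat =>
       ((n%:R)^-1 * supnorm (fun x => F n x - birkhoff T g n x))%:E)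
     < xi%:E)%E.

Definition invariant (T : X -> X) (mu : probability Borel R) : Prop :=
  forall A : set Borel, measurable A -> mu (T @^-1` A) = mu A.

Definition MT (T : X -> X) : set (probability Borel R) :=
  [set mu | invariant T mu].

Definition Fstar (F : nat -> X -> R) (mu : probability Borel R) : R :=
  limn (fun n : nat => (n%:R)^-1 * Rintegral mu [set: Borel] (F n)).

Definition beta_pot (T : X -> X) (F : nat -> X -> R) : \bar R :=
  ereal_sup [set (Fstar F mu)%:E | mu in MT T].
Definition eta_pot (T : X -> X) (F : nat -> X -> R) : \bar R :=
  ereal_inf [set (Fstar F mu)%:E | mu in MT T].

Definition irregular_set (Phi : nat -> X -> R) : set X :=
  [set x | ~ cvg ((fun n : nat => (n%:R)^-1 * Phi n x) @ \oo)].

Definition empirical (T : X -> X) (x : X) (n : nat) :=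
  mscale ((n%:R)^-1 : R)%:nng
    (msum (fun i : nat => @dirac _ Borel (iter i T x) R) n).

Definition weak_cvg (nu : nat -> {measure set Borel -> \bar R})
    (mu : {measure set Borel -> \bar R}) : Prop :=
  forall g : X -> R, continuous g ->
    (fun n => \int[nu n]_x (g x)%:E)%E @ \oo --> (\int[mu]_x (g x)%:E)%E.

Definition Vset (T : X -> X) (x : X) : set (probability Borel R) :=
  [set mu | exists phi : nat -> nat, (forall k, (phi k < phi k.+1)%N) /\
     weak_cvg (fun k => empirical T x (phi k)) mu].

Definition specification (T : X -> X) : Prop :=
  forall eps : R, 0 < eps -> exists m : nat,
    forall (k : nat) (a b : nat -> nat) (xs : nat -> X),
      (forall j, (j < k)%N -> (a j <= b j)%N) ->
      (forall j, (j.+1 < k)%N -> (b j + m <= a j.+1)%N) ->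
      exists x : X, forall j, (j < k)%N -> forall p, (p <= b j - a j)%N ->
        mdist (iter (p + a j) T x) (iter p T (xs j)) < eps.

End Defs.

(* Main.v *)
Require Import Defs.
From HB Require Import structures.
From mathcomp Require Import all_boot all_order all_algebra.
From mathcomp Require Import all_classical all_reals all_analysis.
From mathcomp Require Import measurable_realfun.
From mathcomp Require Import lra zify.
Import Order.TTheory GRing.Theory Num.Theory.
Import numFieldNormedType.Exports.
Local Open Scope classical_set_scope.
Local Open Scope ring_scope.
Set Implicit Arguments.
Unset Strict Implicit.
Unset Printing Implicit Defensive.

(** Let [S1] and [S2] be the two suprema, in the order of the statement; then
    [beta(F) <= S1 <= S2 <= beta(F)].

    [beta(F) <= S1]. If [c] is below the integral of [g] for an invariant
    measure, dominated convergence gives a point whose Birkhoff averages of [g]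
    exceed [c] infinitely often. Apply this to [F] and a given [mu], and to
    [Phi] with two measures on which [Phi_*] differs; this yields three points.
    By specification and compactness one orbit shadows, for a fixed precision,
    ever longer pieces of these three orbits in turn, each piece dwarfing all
    the past. That orbit is [Phi]-irregular and almost realizes [F_*(mu)] as a
    limsup.

    [S1 <= S2]. Empirical measures are weakly sequentially compact. This is
    proved without a representation theorem: code [X] by nested finite
    partitions ordered lexicographically, extract a subsequence along which the
    frequencies of all initial segments of codes converge, and push Lebesgue
    measure on [[0, 1[] forward by the associated quantile map.

    [S2 <= beta(F)]. Elements of [V(x)] are invariant, because continuous
    functions separate Borel measures. *)

(** * Events along arbitrarily large times, and upper limits *)

Definition infinitely_often (P : nat -> Prop) : Prop :=
  forall N, exists2 n, (N <= n)%N & P n.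

Lemma near_infinitely_often (P Q : nat -> Prop) :
  (\forall n \near \oo, Q n) -> infinitely_often P ->
  infinitely_often (fun n => P n /\ Q n).
Proof.
move=> [M _ QM] Pio N; have [n] := Pio (maxn M N).
rewrite geq_max => /andP[Mn Nn] Pn; exists n => //; split=> //; exact: QM.
Qed.

Lemma sub_infinitely_often (P Q : nat -> Prop) :
  (forall n, P n -> Q n) -> infinitely_often P -> infinitely_often Q.
Proof. by move=> PQ Pio N; have [n Nn Pn] := Pio N; exists n => //; exact: PQ. Qed.

Section limn_esup_facts.
Context {R : realType}.
Implicit Types (u : nat -> \bar R) (l : \bar R).
Local Open Scope ereal_scope.

Lemma limn_esup_lt_near u l : limn_esup u < l -> \forall n \near \oo, u n < l.
Proof.
rewrite /limn_esup limf_esupE => /ereal_inf_lt[_ [V nV <-] ltl].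
apply: filterS nV => n Vn; apply: le_lt_trans ltl.
by apply: ereal_sup_ubound; exists n.
Qed.

Lemma lt_limn_esup_io u l : l < limn_esup u -> infinitely_often (fun n => l < u n).
Proof.
rewrite /limn_esup limf_esupE => lts N.
have := lt_le_trans lts (ereal_inf_lbound _).
move=> /(_ _ (ex_intro2 _ _ [set n | (N <= n)%N] (nbhs_infty_ge N) erefl)).
by move=> /ereal_sup_gt[_ [n /= Nn <-] ltn]; exists n.
Qed.

Lemma io_le_limn_esup u l :
  infinitely_often (fun n => l <= u n) -> l <= limn_esup u.
Proof.
move=> io; rewrite /limn_esup limf_esupE.
apply: le_ereal_inf_tmp => _ [V [N _ NV] <-].
have [n Nn ln] := io N; apply: (le_trans ln).
by apply: ereal_sup_ubound; exists n => //; apply: NV.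
Qed.

End limn_esup_facts.

(** * Continuous functions on a compact metric space *)

Section compact_metric.
Context {R : realType} {X : pmetricType R}.
Hypothesis cptX : compact [set: X].
Implicit Types (g h : X -> R).

Lemma continuous_bounded g : continuous g ->
  exists2 M : R, 0 <= M & forall x, `|g x| <= M.
Proof.
move=> cg.
have /compact_bounded[M [_ Mb]] : compact (g @` [set: X]).
  by apply: continuous_compact => //; apply: continuous_subspaceT.
exists (`|M| + 1); first by rewrite addr_ge0.
move=> x; apply: (Mb (`|M| + 1)); last by exists x.
by rewrite (le_lt_trans (ler_norm M))// ltrDl.
Qed.

(** Heine-Cantor from the near-covering form of compactness: if continuity at [x] holds with radius
    [r], then [d < r / 2] works uniformly for all points within [r / 2] of [x]. *)
Lemma continuous_uniform g : continuous g -> forall e : R, 0 < e ->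
  exists2 d : R, 0 < d & forall x y, mdist x y < d -> `|g x - g y| < e.
Proof.
move=> cg e e0.
move/compact_near_coveringP : cptX => /(_ R (0^'+)
  (fun d x => forall y, mdist x y < d -> `|g x - g y| < e)) near_cov.
have : \forall d \near (0:R)^'+, [set: X] `<=`
    (fun x => forall y, mdist x y < d -> `|g x - g y| < e).
  apply: near_cov => x _.
  have /cvgrPdist_lt/(_ (e / 2)) := cg x.
  rewrite divr_gt0// => /(_ isT)/nbhs_ballP[r /= r0 rg].
  exists (ball x (r / 2), [set d | d < r / 2]) => /=.
    split; first by apply: nbhsx_ballx; rewrite divr_gt0.
    by apply: nbhs_right_lt; rewrite divr_gt0.
  move=> [x' d] /= [xx' dr] y x'y.
  have x'gx : `|g x - g x'| < e / 2.
    by apply: rg; apply: le_ball xx'; rewrite ler_pdivrMr// mulrDr mulr1 lerDl ltW.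
  have x'gy : `|g x - g y| < e / 2.
    apply: rg; rewrite (splitr r); apply: ball_triangle xx' _.
    by rewrite ballEmdist/=; exact: lt_trans x'y dr.
  by rewrite (splitr e) (le_lt_trans (ler_distD (g x) _ _))// ltrD// distrC.
move=> nd; near (0:R)^'+ => d; exists d => //.
by move=> x y; have /(_ d) := near nd; apply.
Unshelve. all: by end_near. Qed.

(** The real-valued [sup] dominates a set only when that set is bounded, so some bound [M] has to be
    supplied. *)
Lemma le_supnorm h M : (forall x, `|h x| <= M) -> forall x, `|h x| <= supnorm h.
Proof.
move=> hM x; apply: ub_le_sup; last by exists x.
by exists M => _ [y _ <-].
Qed.

Lemma continuous_Borel_measurable g :
  continuous g -> measurable_fun [set: @Borel R X] (g : @Borel R X -> R).
Proof.
move=> /continuousP cg.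
apply: (measurability _ (RGenOpens.measurableE R)).
move=> _ [_ [a [b ->] <-]]; rewrite setTI; apply: sub_sigma_algebra.
exact/cg/interval_open.
Qed.

Lemma continuous_Borel_measurable_map (T : X -> X) : continuous T ->
  measurable_fun [set: @Borel R X] (T : @Borel R X -> @Borel R X).
Proof.
move=> /continuousP cT.
apply: (@measurability _ _ (@Borel R X) (@Borel R X) setT T (@open X) erefl).
move=> _ [A oA <-]; rewrite setTI; apply: sub_sigma_algebra; exact: cT.
Qed.

End compact_metric.

(** * Integrals against a probability measure *)

Section prob_integral.
Context {R : realType} {d : measure_display} {Y : measurableType d}.
Variable P : probability Y R.

Lemma prob_bounded_integrable (f : Y -> R) (M : R) :
  measurable_fun [set: Y] f -> (forall x, `|f x| <= M) ->
  P.-integrable [set: Y] (EFin \o f).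
Proof.
move=> mf fM; apply: measurable_bounded_integrable => //.
  by rewrite (le_lt_trans (probability_le1 P _))// ltry.
exists M; split; first exact: num_real.
by move=> r Mr x _; exact: le_trans (fM x) (ltW Mr).
Qed.

Lemma prob_Rintegral_cst (r : R) : Rintegral P [set: Y] (fun=> r) = r.
Proof. by rewrite Rintegral_cst//= probability_setT mulr1. Qed.

Lemma prob_Rintegral_dist (f g : Y -> R) (e : R) :
  P.-integrable [set: Y] (EFin \o f) -> P.-integrable [set: Y] (EFin \o g) ->
  (forall x, `|f x - g x| <= e) ->
  `|Rintegral P [set: Y] f - Rintegral P [set: Y] g| <= e.
Proof.
move=> fi gi fge; rewrite -RintegralB//.
have fgi : P.-integrable [set: Y] (EFin \o (fun x => f x - g x)).
  by apply: eq_integrable (integrableB _ fi gi).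
apply: le_trans (le_normr_Rintegral _ fgi) _ => //.
rewrite -[leRHS]prob_Rintegral_cst; apply: le_Rintegral => //.
- by apply: eq_integrable (integrable_abse fgi).
- apply: (@prob_bounded_integrable _ `|e|) => //; exact: measurable_cst.
Qed.

End prob_integral.

(** * Birkhoff sums and shadowing *)

Section birkhoff_facts.
Context {R : realType} {X : pmetricType R}.
Variable T : X -> X.
Implicit Types (g h : X -> R).

Lemma birkhoffD g m n x :
  birkhoff T g (m + n) x = birkhoff T g m x + birkhoff T g n (iter m T x).
Proof.
rewrite /birkhoff big_split_ord/=; congr (_ + _).
by apply: eq_bigr => i _; rewrite addnC iterD.
Qed.

Lemma birkhoff_bound g M n x : (forall y, `|g y| <= M) ->
  `|birkhoff T g n x| <= n%:R * M.
Proof.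
move=> gM; rewrite (le_trans (ler_norm_sum _ _ _))//.
rewrite (le_trans (ler_sum _ (fun i _ => gM _)))//.
by rewrite sumr_const card_ord mulr_natl.
Qed.

Lemma birkhoff_dist g n x y e :
  (forall i, (i < n)%N -> `|g (iter i T x) - g (iter i T y)| <= e) ->
  `|birkhoff T g n x - birkhoff T g n y| <= n%:R * e.
Proof.
move=> ge; rewrite /birkhoff -sumrB (le_trans (ler_norm_sum _ _ _))//.
rewrite (le_trans (ler_sum _ (fun i _ => ge _ (ltn_ord i))))//.
by rewrite sumr_const card_ord mulr_natl.
Qed.

Lemma birkhoffN g n x : birkhoff T (\- g) n x = - birkhoff T g n x.
Proof. by rewrite /birkhoff sumrN. Qed.

Lemma continuous_iter n : continuous T -> continuous (iter n T).
Proof.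
move=> cT; elim: n => [|n IH] x /=; first exact: cvg_id.
by apply: continuous_comp; [exact: IH|exact: cT].
Qed.

Lemma continuous_birkhoff g n : continuous T -> continuous g ->
  continuous (birkhoff T g n).
Proof.
move=> cT cg; elim: n => [|n IH] x.
  by rewrite /birkhoff; under eq_fun do rewrite big_ord0; exact: cvg_cst.
rewrite /birkhoff; under eq_fun do rewrite big_ord_recr/=.
apply: cvgD; first exact: IH.
by apply: continuous_comp; [exact: continuous_iter|exact: cg].
Qed.

End birkhoff_facts.

Section shadowing.
Context {R : realType} {X : pmetricType R}.
Variable T : X -> X.
Hypotheses (cptX : compact [set: X]) (cT : continuous T).
Hypothesis specT : specification T.

(** Specification handles the first [k] pieces for each [k]; a cluster point of the resulting
    points, exists by compactness, shadows all pieces. Passing to the limit weakens the strict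
    inequality to a large one. *)
Lemma specification_infinite (eps : R) : 0 < eps -> exists m : nat,
  forall (a b : nat -> nat) (xs : nat -> X),
    (forall j, (a j <= b j)%N) -> (forall j, (b j + m <= a j.+1)%N) ->
    exists x, forall j p, (p <= b j - a j)%N ->
      mdist (iter (p + a j) T x) (iter p T (xs j)) <= eps.
Proof.
move=> eps0; have [m spec] := specT eps0; exists m => a b xs ab ba.
have /choice[x_ x_P] : forall k : nat, exists x, forall j, (j < k)%N ->
    forall p, (p <= b j - a j)%N ->
    mdist (iter (p + a j) T x) (iter p T (xs j)) < eps.
  by move=> k; exact: spec.
have [x [_ xcl]] := cptX (fmap_proper_filter x_ eventually_filter) filterT.
exists x => j p pj; rewrite leNgt; apply/negP => lt_eps.
set w := iter p T (xs j) in lt_eps *.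
set r := mdist (iter (p + a j) T x) w - eps.
have r0 : 0 < r by rewrite subr_gt0.
have nx : \forall z \near x, ball (iter (p + a j) T x) r (iter (p + a j) T z).
  by have /cvg_ballP/(_ _ r0) := @continuous_iter _ _ T (p + a j) cT x.
have nF : (x_ @ \oo) [set z | mdist (iter (p + a j) T z) w < eps].
  by exists j.+1 => // k /= jk; exact: x_P.
have [z /= [zw]] := xcl _ _ nF nx.
rewrite ballEmdist/= => xz.
have := ball_triangle (y := iter (p + a j) T z) (x := iter (p + a j) T x) (z := w).
move=> /(_ r eps); rewrite !ballEmdist/= => /(_ xz zw).
by rewrite subrK ltxx.
Qed.

(** One orbit follows the points [u i] cyclically, piece [j] following [u (j %% k)]. At the end of a
    piece the Birkhoff sum is dominated by that piece, so the single point inherits all [k] lower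
    bounds, up to [delta]: half is spent on shadowing, half on the past. *)
Lemma shadow_birkhoff (k : nat) (u : nat -> X) (g : nat -> X -> R)
    (c : nat -> R) (delta : R) :
  (forall i, continuous (g i)) -> 0 < delta ->
  (forall i, (i < k)%N ->
     infinitely_often (fun n => c i * n%:R <= birkhoff T (g i) n (u i))) ->
  exists x, forall i, (i < k)%N -> infinitely_often
    (fun n => (c i - delta) * n%:R <= birkhoff T (g i) n x).
Proof.
move=> cg delta0 io.
have [eps eps0 epsP] : exists2 eps : R, 0 < eps & forall i x y, (i < k)%N ->
    mdist x y <= eps -> `|g i x - g i y| <= delta / 2.
  elim: k {io} => [|k [e1 e10 e1P]]; first by exists 1.
  have [|e2 e20 e2P] := @continuous_uniform _ _ cptX _ (cg k) (delta / 2).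
    by rewrite divr_gt0.
  exists (Num.min e1 (e2 / 2)); first by rewrite lt_min e10 divr_gt0.
  move=> i x y; rewrite ltnS le_min leq_eqVlt => /predU1P[->|ik] /andP[xy1 xy2].
    by apply/ltW/e2P; rewrite (le_lt_trans xy2)// ltr_pdivrMr// mulrDr mulr1 ltrDl.
  exact: e1P.
have [->|k0] := posnP k; first by exists point.
have [m shad] := specification_infinite eps0.
have [L LP] : exists L : nat -> nat -> nat, forall j N, (N <= L j N)%N /\
    c (j %% k)%N * (L j N)%:R <= birkhoff T (g (j %% k)%N) (L j N) (u (j %% k)%N).
  have /choice[L LP] : forall jN : nat * nat, exists n, (jN.2 <= n)%N /\
    c (jN.1 %% k)%N * n%:R <= birkhoff T (g (jN.1 %% k)%N) n (u (jN.1 %% k)%N).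
    move=> [j N]/=; have [|n] := io (j %% k)%N _ N; first exact: ltn_pmod.
    by exists n.
  by exists (fun j N => L (j, N)) => j N; exact: (LP (j, N)).
(* Piece [j] starts at time [a j] and has length [l j], more than [j.+1] times its starting time; a
   gap [m] follows. The outer [.+1] keeps [l j] positive even when [a j = 0]. *)
pose a := fix a (j : nat) : nat :=
  if j is i.+1 then (a i + L i ((i.+1 * a i).+1) + m)%N else 0%N.
pose l j := L j ((j.+1 * a j).+1).
have aS j : a j.+1 = (a j + l j + m)%N by [].
have l_ge j : ((j.+1 * a j).+1 <= l j)%N by case: (LP j ((j.+1 * a j).+1)).
have a_ge j : (j <= a j)%N.
  by elim: j => // j IH; rewrite aS; have := l_ge j; lia.
(* Specification uses closed intervals, so a piece of length [l j] ends at [a j + (l j).-1]. *)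
have [|| x xP] := shad a (fun j => (a j + (l j).-1)%N) (fun j => u (j %% k)%N).
- by move=> j; rewrite leq_addr.
- by move=> j; rewrite aS; have := l_ge j; lia.
exists x => i ik N.
have [M M0 gM] := continuous_bounded cptX (cg i).
(* From piece [J] on, the past costs at most [a j * (M + |c i|)], which is below
   [l j * (delta / 2)]: [M] bounds the past sum and [|c i|] pays for the threshold over those
   times. *)
have [J JP] : exists J : nat, M + `|c i| <= J%:R * (delta / 2).
  exists (Num.truncn ((M + `|c i|) / (delta / 2))).+1.
  rewrite -ler_pdivrMr ?divr_gt0//; apply/ltW/truncnS_gt.
(* A piece assigned to [u i], late enough both for the estimate and for the time bound [N]. *)
pose j := ((J + N) * k + i)%N.
have jk : (j %% k = i)%N by rewrite modnMDl modn_small.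
have leJ : (J + N <= j)%N by rewrite /j; nia.
exists (a j + l j)%N; first by have := a_ge j; lia.
have [_ /=] := LP j ((j.+1 * a j).+1); rewrite -/(l j) jk => Sl.
have Sa := birkhoff_bound T (a j) x gM.
have Sx : `|birkhoff T (g i) (l j) (iter (a j) T x) -
            birkhoff T (g i) (l j) (u i)| <= (l j)%:R * (delta / 2).
  apply: birkhoff_dist => p pl; apply: epsP => //.
  have := xP j p; rewrite jk addKn -iterD; apply.
  by move: pl; have := l_ge j; lia.
rewrite birkhoffD natrD.
move: Sa Sx; rewrite !ler_norml => /andP[Sa _] /andP[Sx _].
have la : (a j)%:R * (M + `|c i|) <= (l j)%:R * (delta / 2).
  apply: (@le_trans _ _ ((a j)%:R * (J%:R * (delta / 2)))).
    by rewrite ler_wpM2l.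
  rewrite mulrA ler_wpM2r ?divr_ge0 ?(ltW delta0)// -natrM ler_nat.
  by apply: leq_trans (ltnW (l_ge j)); rewrite mulnC leq_mul2r; apply/orP; right; lia.
have a0 : 0 <= (a j)%:R :> R by [].
have ca : (a j)%:R * c i <= (a j)%:R * `|c i| by rewrite ler_wpM2l// ler_norm.
have da : 0 <= (a j)%:R * delta by rewrite mulr_ge0// ltW.
move: Sl la; move: Sa Sx ca da.
set A := (a j)%:R; set B := (l j)%:R.
by rewrite !mulrDr; nra.
Qed.

End shadowing.

(** * Integrals of Birkhoff sums and of additive potentials *)

Section invariant_integrals.
Context {R : realType} {X : pmetricType R}.
Variable T : X -> X.
Hypotheses (cptX : compact [set: X]) (cT : continuous T).
Implicit Types (mu : probability (@Borel R X) R) (g : X -> R).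

Lemma continuous_integrable mu g : continuous g ->
  mu.-integrable [set: @Borel R X] (EFin \o g).
Proof.
move=> cg; have [M _ gM] := continuous_bounded cptX cg.
exact: prob_bounded_integrable (continuous_Borel_measurable cg) gM.
Qed.

(** Invariance says that [mu] equals its pushforward under [T]; the rest is change of variables. *)
Lemma MT_integral_comp mu g : MT T mu -> continuous g ->
  Rintegral mu [set: @Borel R X] (g \o T) = Rintegral mu [set: @Borel R X] g.
Proof.
move=> Tmu cg; rewrite /Rintegral; congr fine.
have mT := continuous_Borel_measurable_map cT.
have mg := continuous_Borel_measurable cg.
have cgT : continuous (g \o T).
  by move=> x; apply: continuous_comp; [exact: cT|exact: cg].
have := continuous_integrable mu cgT; rewrite -[setT](preimage_setT T) => igT.
rewrite (_ : (\int[mu]_x (g x)%:E)%E =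
    (\int[pushforward mu (T : @Borel R X -> @Borel R X)]_x (g x)%:E)%E).
  rewrite (integral_pushforward mT _ igT)//; last exact/measurable_EFinP.
by apply: eq_measure_integral => A mA _; exact: (esym (Tmu A mA)).
Qed.

Lemma MT_integral_birkhoff mu g n : MT T mu -> continuous g ->
  Rintegral mu [set: @Borel R X] (birkhoff T g n) =
  n%:R * Rintegral mu [set: @Borel R X] g.
Proof.
move=> Tmu cg; elim: n => [|n IH].
  rewrite mul0r -[RHS](prob_Rintegral_cst mu); apply: eq_Rintegral => x _.
  by rewrite /birkhoff big_ord0.
have -> : birkhoff T g n.+1 = (fun x => birkhoff T g n x + g (iter n T x)).
  by apply/funext => x; rewrite /birkhoff big_ord_recr.
have cgn m : continuous (fun x => g (iter m T x)).
  by move=> x; apply: continuous_comp; [exact: continuous_iter|exact: cg].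
rewrite RintegralD//; last 2 first.
- exact: continuous_integrable (continuous_birkhoff cT cg).
- exact: continuous_integrable (cgn n).
rewrite IH -natr1 mulrDl mul1r; congr (_ + _); elim: n {IH} => // n IH.
rewrite -IH -(MT_integral_comp Tmu (cgn n)).
by apply: eq_Rintegral => x _; rewrite /= -iterSr.
Qed.

(** No ergodic theorem is involved. If no such point existed, the positive part [h n] of the average
    minus [c] would vanish eventually at every point. Dominated convergence would send its integral
    to 0, whereas invariance keeps that integral at least the integral of [g] minus [c]. *)
Lemma MT_point_above mu g c : MT T mu -> continuous g ->
  c < Rintegral mu [set: @Borel R X] g ->
  exists y, infinitely_often (fun n => c * n%:R <= birkhoff T g n y).
Proof.
move=> Tmu cg cltI; apply: contrapT => nex.
have [M M0 gM] := continuous_bounded cptX cg.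
pose h n x : R := Num.max (n%:R^-1 * birkhoff T g n x - c) 0.
have ch n : continuous (h n).
  have cf : continuous (fun x => n%:R^-1 * birkhoff T g n x - c : R^o).
    move=> x; apply: cvgB; last exact: cvg_cst.
    by apply: cvgM; [exact: cvg_cst|exact: continuous_birkhoff].
  by move=> x; apply: (@continuous_max R X _ (fun=> 0) x (cf x)); exact: cvg_cst.
have hM n x : `|h n x| <= M + `|c|.
  have : `|n%:R^-1 * birkhoff T g n x| <= M.
    rewrite normrM ger0_norm ?invr_ge0//.
    have [->|n0] := posnP n; first by rewrite invr0 mul0r.
    by rewrite mulrC ler_pdivrMr ?ltr0n// mulrC birkhoff_bound.
  rewrite /h; have := ler_norm c; have := ler_norm (- c).
  rewrite normrN !ler_norml => cN cP.
  set a := n%:R^-1 * _ => /andP[? ?].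
  have : 0 <= `|c| by []. move: cN cP; set b := `|c| => ? ? ?.
  by case: (ltP (a - c) 0) => ?; apply/andP; split; lra.
have h0 x : (fun n => (h n x)%:E) @ \oo --> (0 : \bar R).
  apply: cvg_near_cst; apply: contrapT => hn0; apply: nex; exists x => N.
  apply: contrapT => nx; apply: hn0; exists N.+1 => // n /= Nn.
  rewrite /h max_r// subr_le0 ler_pdivrMl; last by rewrite ltr0n; lia.
  rewrite mulrC leNgt; apply/negP => lt; apply: nx; exists n; first lia.
  exact: ltW.
have [] := @dominated_convergence _ (@Borel R X) _ mu [set: @Borel R X]
  measurableT (fun n x => (h n x)%:E) (fun=> 0%E) (fun=> (M + `|c|)%:E).
- by move=> n; apply/measurable_EFinP; exact: continuous_Borel_measurable.
- exact: measurable_cst.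
- by apply: aeW => x _; exact: h0.
- exact: finite_measure_integrable_cst.
- by apply: aeW => x n _; rewrite abse_EFin lee_fin.
move=> _ _; rewrite integral0 => /fine_cvgP[_] /cvgrPdist_lt.
move=> /(_ (Rintegral mu [set: @Borel R X] g - c)).
rewrite subr_gt0 => /(_ cltI)[N _ /(_ N.+1 (leqnSn N))] /=.
rewrite sub0r normrN.
set I := fine _; have -> : I = Rintegral mu [set: @Borel R X] (h N.+1) by [].
rewrite ger0_norm; last by apply: Rintegral_ge0 => x _; rewrite /h le_max lexx orbT.
apply/negP; rewrite -leNgt.
(* The index [N.+1] is nonzero, so the average integrates exactly to the integral of [g]. *)
have <- : Rintegral mu [set: @Borel R X]
    (fun x => N.+1%:R^-1 * birkhoff T g N.+1 x - c) =
   Rintegral mu [set: @Borel R X] g - c.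
  rewrite RintegralB//; last 2 first.
  - apply: continuous_integrable => x.
    by apply: cvgM; [exact: cvg_cst|exact: continuous_birkhoff].
  - apply: (continuous_integrable mu) => x; exact: cvg_cst.
  rewrite prob_Rintegral_cst RintegralZl//; last first.
    exact: continuous_integrable (continuous_birkhoff cT cg).
  by rewrite MT_integral_birkhoff// mulKf.
apply: le_Rintegral => //.
- apply: continuous_integrable => x; apply: cvgB; last exact: cvg_cst.
  by apply: cvgM; [exact: cvg_cst|exact: continuous_birkhoff].
- exact: continuous_integrable (ch _).
- by move=> x _; rewrite /h le_max lexx.
Qed.

End invariant_integrals.

Section additive_potentials.
Context {R : realType} {X : pmetricType R}.
Variables (T : X -> X) (F : nat -> X -> R).
Hypotheses (cptX : compact [set: X]) (cT : continuous T) (aapF : AAP T F).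
Implicit Types (mu : probability (@Borel R X) R).

(** The form in which asymptotic additivity is used everywhere below: a uniform bound valid at all
    late times. *)
Lemma AAP_birkhoff (xi : R) : 0 < xi -> exists2 g : X -> R, continuous g &
  \forall n \near \oo, forall x, `|F n x - birkhoff T g n x| <= xi * n%:R.
Proof.
move=> xi0; have [cF /(_ _ xi0)[g [cg /limn_esup_lt_near gxi]]] := aapF.
exists g => //; near=> n => x.
have n0 : (0 < n)%N by near: n; exact: nbhs_infty_gt.
have cd : continuous (fun x => F n x - birkhoff T g n x).
  by move=> y; apply: cvgB; [exact: cF|exact: continuous_birkhoff].
have [M _ dM] := continuous_bounded cptX cd.
apply: le_trans (le_supnorm dM x) _.
rewrite mulrC -ler_pdivrMl ?ltr0n//; apply: ltW; rewrite -lte_fin.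
by near: n.
Unshelve. all: by end_near. Qed.

(** Since [Fstar] is a [limn], it carries information only once the sequence is known to converge.
    The sequence is Cauchy because the integral of any approximant is eventually close to it; the
    bound for [g] then passes to the limit. *)
Lemma AAP_Fstar mu (g : X -> R) (xi : R) : MT T mu -> continuous g ->
  (\forall n \near \oo, forall x, `|F n x - birkhoff T g n x| <= xi * n%:R) ->
  `|Fstar F mu - Rintegral mu [set: @Borel R X] g| <= xi.
Proof.
move=> Tmu cg Fg.
pose a n : R := n%:R^-1 * Rintegral mu [set: @Borel R X] (F n).
have ag (h : X -> R) (e : R) : continuous h ->
    (\forall n \near \oo, forall x, `|F n x - birkhoff T h n x| <= e * n%:R) ->
    \forall n \near \oo, `|a n - Rintegral mu [set: @Borel R X] h| <= e.
  move=> ch Fh; near=> n.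
  have n0 : (0 < n)%N by near: n; exact: nbhs_infty_gt.
  have n0' : 0 < n%:R :> R by rewrite ltr0n.
  have -> : Rintegral mu [set: @Borel R X] h =
      n%:R^-1 * Rintegral mu [set: @Borel R X] (birkhoff T h n).
    by rewrite (MT_integral_birkhoff cptX)// mulKf// gt_eqF.
  rewrite /a -mulrBr normrM ger0_norm ?invr_ge0//.
  rewrite ler_pdivrMl// mulrC; apply: prob_Rintegral_dist.
  - by apply: continuous_integrable => //; case: aapF => cF _; exact: cF.
  - by apply: continuous_integrable => //; exact: continuous_birkhoff.
  - by near: n.
have : cvg (a @ \oo).
  apply/cauchy_cvgP/cauchy_exP => e e0.
  have [|h ch Fh] := @AAP_birkhoff (e / 2); first by rewrite divr_gt0.
  exists (Rintegral mu [set: @Borel R X] h); near=> n.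
  rewrite /ball/= distrC (@le_lt_trans _ _ (e / 2))//.
    by near: n; exact: ag.
  by rewrite ltr_pdivrMr// mulrDr mulr1 ltrDl.
move=> cva; have cvd : (fun n => `|a n - Rintegral mu [set: @Borel R X] g|) @ \oo -->
    `|Fstar F mu - Rintegral mu [set: @Borel R X] g|.
  by apply: cvg_norm; apply: cvgB; [exact: cva|exact: cvg_cst].
rewrite -(cvg_lim _ cvd)//; apply: limr_le; first exact: cvgP cvd.
exact: ag.
Unshelve. all: by end_near. Qed.

End additive_potentials.

(** * Weak limits of empirical measures are invariant *)

Section separating_continuous.
Context {R : realType} {X : pmetricType R}.
Implicit Types (O : set X) (x y : X).

(* The truncation at 1 covers the case O = setT. *)
Definition codist O x : R := inf ([set 1] `|` [set mdist x a | a in ~` O]).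

Let codist_has_lb O x : has_lbound ([set 1] `|` [set mdist x a | a in ~` O]).
Proof. by exists 0 => _ [->//|[a _ <-]]; exact: mdist_ge0. Qed.

Lemma codist_ge0 O x : 0 <= codist O x.
Proof.
by apply: lb_le_inf => [|_ [->//|[a _ <-]]]; [exists 1; left|exact: mdist_ge0].
Qed.

Lemma codist_lipschitz O x y : codist O x <= codist O y + mdist x y.
Proof.
rewrite -lerBlDr; apply: lb_le_inf; first by exists 1; left.
move=> _ [->|[a Oa <-]]; rewrite lerBlDr.
  by apply: le_trans (ge_inf _ _) _; [|left; reflexivity|rewrite lerDl mdist_ge0].
apply: le_trans (ge_inf (codist_has_lb O x) _) _; first by right; exists a.
by rewrite addrC; exact: metric_triangle.
Qed.

Lemma continuous_codist O : continuous (codist O).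
Proof.
move=> x; apply/cvgrPdist_lt => e e0; near=> y.
have xy : mdist x y < e.
  have : ball x e y by near: y; exact: nbhsx_ballx.
  by rewrite ballEmdist.
have := codist_lipschitz O x y; have := codist_lipschitz O y x.
rewrite (metric_sym y x) ltr_norml => ? ?; apply/andP; split; lra.
Unshelve. all: by end_near. Qed.

Lemma codist_gt0 O x : open O -> O x -> 0 < codist O x.
Proof.
move=> oO Ox.
have /nbhs_ballP[r /= r0 rO] : nbhs x O by apply: open_nbhs_nbhs; split.
apply: (@lt_le_trans _ _ (Num.min 1 r)); first by rewrite lt_min ltr01.
apply: lb_le_inf => [|_ [->|[a Oa <-]]]; first by exists 1; left.
  by rewrite ge_min lexx.
rewrite ge_min; apply/orP; right; rewrite leNgt; apply/negP => ar.
by apply/Oa/rO; rewrite ballEmdist.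
Qed.

Lemma codist_eq0 O x : ~ O x -> codist O x = 0.
Proof.
move=> Ox; apply/eqP; rewrite eq_le codist_ge0 andbT.
by apply: (ge_inf (codist_has_lb O x)); right; exists x => //; exact: mdistxx.
Qed.

(** The functions [min 1 (k * codist O)] increase to the indicator of an open set [O], so the
    measures agree on open sets. These are stable under intersection and generate the Borel sets. *)
Lemma Borel_measure_unique (m1 m2 : {measure set (@Borel R X) -> \bar R}) :
  (m1 setT < +oo)%E ->
  (forall g : X -> R, continuous g -> (forall x, 0 <= g x) ->
    (forall x, g x <= 1) ->
    (\int[m1]_x (g x)%:E = \int[m2]_x (g x)%:E)%E) ->
  forall A : set (@Borel R X), measurable A -> m1 A = m2 A.
Proof.
move=> m1T m12.
have oP (m : {measure set (@Borel R X) -> \bar R}) O : open O -> m O =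
    limn (fun k : nat => \int[m]_x (Num.min 1 (k%:R * codist O x))%:E)%E.
  move=> oO.
  have mO : measurable (O : set (@Borel R X)) by exact: sub_sigma_algebra.
  rewrite -monotone_convergence//=.
  - transitivity (\int[m]_x (\1_(O : set (@Borel R X)) x)%:E)%E.
      by rewrite integral_indic// setIT.
    apply: eq_integral => x _.
    apply/esym/cvg_lim => //; have [Ox|Ox] := pselect (O x).
      rewrite indicE mem_set//; apply: cvg_near_cst.
      have d0 := codist_gt0 oO Ox.
      exists (Num.truncn (codist O x)^-1).+1 => // k /= kd.
      congr EFin; apply: min_idPl; rewrite -ler_pdivrMr// div1r.
      by apply: le_trans (ltW (truncnS_gt _)) _; rewrite ler_nat.
    rewrite indicE memNset// codist_eq0//; apply: cvg_near_cst; apply: nearW => k.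
    by rewrite mulr0 /Num.min ltNge ler01.
  - move=> k; apply/measurable_EFinP; apply: continuous_Borel_measurable.
    have cc : continuous (fun x => k%:R * codist O x : R^o).
      by move=> x; apply: cvgM; [exact: cvg_cst|exact: continuous_codist].
    by move=> x; apply: (@continuous_min R X (fun=> 1) _ x _ (cc x)); exact: cvg_cst.
  - by move=> k x _; rewrite lee_fin le_min ler01 mulr_ge0// codist_ge0.
  - move=> x _ j k jk; rewrite lee_fin le_min ge_min lexx/= ge_min.
    by rewrite ler_wpM2r ?orbT ?codist_ge0// ler_nat.
move=> A mA.
apply: (@g_sigma_algebra_measure_unique _ R (@Borel R X) (@open X) _
  (fun=> setT) _ _ m1 m2 _ _ _ A mA) => //.
- by move=> B oB; exact: sub_sigma_algebra.
- by move=> _; exact: openT.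
- by rewrite bigcup_const//; exists 0%N.
- by move=> B C; exact: openI.
move=> O oO; rewrite (oP m1 _ oO) (oP m2 _ oO); congr (limn _).
apply/funext => k; apply: m12 => [|x|x].
- have cc : continuous (fun x => k%:R * codist O x : R^o).
    by move=> x; apply: cvgM; [exact: cvg_cst|exact: continuous_codist].
  by move=> x; apply: (@continuous_min R X (fun=> 1) _ x _ (cc x)); exact: cvg_cst.
- by rewrite le_min ler01 mulr_ge0// codist_ge0.
- by rewrite ge_min lexx.
Qed.

End separating_continuous.

Section empirical_limits.
Context {R : realType} {X : pmetricType R}.
Variable T : X -> X.
Hypotheses (cptX : compact [set: X]) (cT : continuous T).
Implicit Types (mu : probability (@Borel R X) R) (g : X -> R).

Lemma integral_empirical g n x : continuous g ->
  (\int[empirical T x n]_y (g y)%:E)%E = (n%:R^-1 * birkhoff T g n x)%:E.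
Proof.
move=> cg; have mg := continuous_Borel_measurable cg.
have ge0E (h : @Borel R X -> R) : measurable_fun setT h -> (forall y, 0 <= h y) ->
    (\int[empirical T x n]_y (h y)%:E)%E = (n%:R^-1 * birkhoff T h n x)%:E.
  move=> mh h0; have mh' : measurable_fun setT (EFin \o h) by exact/measurable_EFinP.
  have h0' y : [set: @Borel R X] y -> (0 <= (EFin \o h) y)%E.
    by move=> _; rewrite lee_fin.
  rewrite (ge0_integral_mscale _ measurableT _ mh' h0').
  rewrite (ge0_integral_measure_sum _ measurableT h0' mh').
  rewrite EFinM /birkhoff -sumEFin; congr (_ * _)%E; apply: eq_bigr => i _.
  by rewrite integral_dirac// diracT mul1e.
(* The formula for nonnegative functions extends to [g] through its positive and negative parts. *)
rewrite integralE (funerpos g) (funerneg g).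
rewrite (ge0E g^\+)//; last exact: measurable_funrpos.
rewrite (ge0E g^\-)//; last exact: measurable_funrneg.
rewrite -EFinB -mulrBr /birkhoff -sumrB; congr (_ * _)%:E.
by apply: eq_bigr => i _; rewrite -[in RHS](funrposBneg g).
Qed.

Lemma weak_cvg_empirical mu x (phi : nat -> nat) :
  weak_cvg (fun k => empirical T x (phi k)) mu <->
  forall g, continuous g ->
    (fun k => (phi k)%:R^-1 * birkhoff T g (phi k) x) @ \oo -->
    Rintegral mu [set: @Borel R X] g.
Proof.
have E g : continuous g -> (fun k => \int[empirical T x (phi k)]_y (g y)%:E)%E =
    EFin \o (fun k => (phi k)%:R^-1 * birkhoff T g (phi k) x).
  by move=> cg; apply/funext => k; exact: integral_empirical.
have I g : continuous g -> (\int[mu]_y (g y)%:E)%E =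
    (Rintegral mu [set: @Borel R X] g)%:E.
  by move=> cg; rewrite fineK// integrable_fin_num//; exact: continuous_integrable.
split=> W g cg; have := W g cg; rewrite E// I//.
  by move=> /fine_cvgP[].
by move=> ?; apply/fine_cvgP; split => //; exact: nearW.
Qed.

(** The Birkhoff sums of [g \o T] and [g] differ by the telescoped [g (T^n x) - g x], which is
    bounded and disappears after division by [n]. Hence [mu] and its pushforward integrate
    continuous functions alike. *)
Lemma Vset_invariant x mu : Vset T x mu -> MT T mu.
Proof.
move=> [phi [phiS /weak_cvg_empirical W]].
have phi_ge k : (k <= phi k)%N.
  by elim: k => // k IH; apply: leq_ltn_trans IH (phiS k).
have I_comp g : continuous g ->
    Rintegral mu [set: @Borel R X] (g \o T) = Rintegral mu [set: @Borel R X] g.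
  move=> cg; have [M M0 gM] := continuous_bounded cptX cg.
  have cgT : continuous (g \o T).
    by move=> y; apply: continuous_comp; [exact: cT|exact: cg].
  have tel m : birkhoff T (g \o T) m x - birkhoff T g m x = g (iter m T x) - g x.
    elim: m => [|m IH]; first by rewrite /birkhoff !big_ord0 !subrr.
    move: IH; rewrite /birkhoff !big_ord_recr/=; lra.
  have := cvgB (W _ cgT) (W _ cg).
  set u := (X in X @ _ --> _) => cu; apply/eqP; rewrite -subr_eq0; apply/eqP.
  rewrite -(cvg_lim (@Rhausdorff R) (cu _)); apply: cvg_lim => //.
  apply/cvgrPdist_lt => e e0; near=> k; rewrite sub0r normrN.
  have phik0 : (0 < phi k)%N.
    by apply: leq_trans (phi_ge k); near: k; exact: nbhs_infty_gt.
  have -> : u k = (phi k)%:R^-1 * (g (iter (phi k) T x) - g x).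
    rewrite -tel mulrBr; reflexivity.
  rewrite normrM ger0_norm ?invr_ge0// mulrC ltr_pdivrMr ?ltr0n//.
  apply: (@le_lt_trans _ _ (M + M)).
    by rewrite (le_trans (ler_normB _ _))// lerD.
  rewrite mulrC -ltr_pdivrMr//; apply: lt_le_trans (truncnS_gt _) _.
  by rewrite ler_nat; apply: leq_trans (phi_ge k); near: k; exact: nbhs_infty_ge.
move=> A mA; have mT := continuous_Borel_measurable_map cT.
apply/esym; have muT : (mu [set: @Borel R X] < +oo)%E.
  by rewrite (le_lt_trans (probability_le1 mu _))// ltry.
apply: (@Borel_measure_unique R X mu
  (pushforward mu (T : @Borel R X -> @Borel R X)) muT _ A mA).
move=> g cg g0 g1.
rewrite ge0_integral_pushforward//; last 2 first.
- by apply/measurable_EFinP; exact: continuous_Borel_measurable.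
- by move=> y _; rewrite lee_fin.
have cgT : continuous (g \o T).
  by move=> y; apply: continuous_comp; [exact: cT|exact: cg].
have := congr1 EFin (I_comp g cg); rewrite /Rintegral !fineK; last 2 first.
- exact: integrable_fin_num (continuous_integrable cptX mu cg).
- exact: integrable_fin_num (continuous_integrable cptX mu cgT).
by move=> <-; rewrite preimage_setT.
Unshelve. all: by end_near. Qed.

End empirical_limits.

(** * Weak sequential compactness of empirical measures *)

Section diagonal.
Context {R : realType}.

(** An ultrafilter containing all tails of [A] gives every [q j] a limit at once. At stage [k] one
    then picks a later time in [A] at which the first [k.+1] sequences are within [1 / k.+1] of
    their limits. *)
Lemma bounded_diagonal (A : nat -> Prop) (q : nat -> nat -> R) :
  infinitely_often A -> (forall j n, `|q j n| <= 1) ->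
  exists phi : nat -> nat, exists l : nat -> R,
    [/\ forall k, (phi k < phi k.+1)%N, forall k, A (phi k) &
        forall j, (fun k => q j (phi k)) @ \oo --> l j].
Proof.
move=> Aio q1.
pose F : set_system nat := filter_from [set: nat] (fun N n => (N <= n)%N /\ A n).
have FF : ProperFilter F.
  apply: filter_from_proper => [|N _]; last by have [n Nn An] := Aio N; exists n.
  apply: filter_from_filter => [|i j _ _]; first by exists 0%N.
  exists (maxn i j) => // n [] /=; rewrite geq_max => /andP[? ?] An.
  by split.
have [U [UU FU]] := ultraFilterLemma FF.
have UP : ProperFilter U by exact: ultra_proper.
have qU j : exists l : R, forall e, 0 < e -> U [set n | `|l - q j n| < e].
  have qI : (q j @ U) `[-1, 1]%classic.
    by apply: (@filterS _ U _ setT) filterT => n _ /=; rewrite in_itv/= -ler_norml.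
  have [l [_ lcl]] := segment_compact (fmap_proper_filter (q j) UP) qI.
  exists l => e e0.
  have [//|UC] := in_ultra_setVsetC [set n | `|l - q j n| < e] UU.
  have qC : (q j @ U) [set y | ~ `|l - y| < e] by [].
  by have [y [yC /= /yC]] := lcl _ _ qC (nbhsx_ballx l e e0).
have {qU} [l lP] := choice qU.
have sel k N : exists n, [/\ (N < n)%N, A n &
    forall j, (j <= k)%N -> `|l j - q j n| < k.+1%:R^-1].
  have U1 : U [set n | (N < n)%N /\ A n] by apply: FU; exists N.+1.
  have U2 : U [set n | forall j, (j <= k)%N -> `|l j - q j n| < k.+1%:R^-1].
    elim: {1}k => [|i IH]; last first.
      apply: filterS (filterI IH (lP i.+1 k.+1%:R^-1 _)); last by rewrite invr_gt0.
      move=> n [/= H1 H2] j; rewrite leq_eqVlt => /predU1P[->//|]; exact: H1.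
    apply: filterS (lP 0%N k.+1%:R^-1 _); last by rewrite invr_gt0.
    by move=> n /= H j; rewrite leqn0 => /eqP ->.
  have [n [[Nn An] Hn]] := filter_ex (filterI U1 U2).
  by exists n.
have {sel} [s sP] : exists s : nat -> nat -> nat, forall k N, [/\ (N < s k N)%N,
    A (s k N) & forall j, (j <= k)%N -> `|l j - q j (s k N)| < k.+1%:R^-1].
  have /choice[s sP] : forall kN : nat * nat, exists n, [/\ (kN.2 < n)%N, A n &
      forall j, (j <= kN.1)%N -> `|l j - q j n| < kN.1.+1%:R^-1].
    by move=> [k N]; exact: sel.
  by exists (fun k N => s (k, N)) => k N; exact: (sP (k, N)).
pose phi := fix phi k := if k is i.+1 then s k (phi i) else s 0%N 0%N.
have phiP k : A (phi k) /\
    forall j, (j <= k)%N -> `|l j - q j (phi k)| < k.+1%:R^-1.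
  by case: k => [|k]; [have [] := sP 0%N 0%N|have [] := sP k.+1 (phi k)].
exists phi, l; split=> [k|k|j].
- by have [] := sP k.+1 (phi k).
- by case: (phiP k).
- apply/cvgrPdist_lt => e e0; near=> k.
  have [_ /(_ j) /=] := phiP k; have -> : (j <= k)%N.
    by near: k; exact: nbhs_infty_ge.
  move=> /(_ isT) /lt_trans; apply.
  by near: k; exact: (near_infty_natSinv_lt (PosNum e0)).
Unshelve. all: by end_near. Qed.

End diagonal.

Section codes.
Context {R : realType} {X : pmetricType R}.
Hypothesis cptX : compact [set: X].

(** The label is the index of the first ball containing the point, in a finite cover by balls of
    radius [r / 2]. *)
Lemma finite_labelling (r : R) : 0 < r -> exists (M : nat) (f : X -> nat),
  (forall x, (f x < M)%N) /\ forall x y, f x = f y -> mdist x y < r.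
Proof.
move=> r0; have r20 : 0 < r / 2 by rewrite divr_gt0.
have := cptX; rewrite compact_cover => /(_ X setT (fun x => (ball x (r / 2))^°)).
case=> [x _|x _|D _ Dcov]; first exact: open_interior.
  by exists x => //; exact: nbhsx_ballx.
pose s := finmap.enum_fset D.
have sP x : has (fun p => `[< ball p (r / 2) x >]) s.
  have [p /= pD /interior_subset px] := Dcov x I.
  by apply/hasP; exists p => //; apply/asboolP.
exists (size s), (fun x => find (fun p => `[< ball p (r / 2) x >]) s); split.
  by move=> x; rewrite -has_find.
move=> x y xy; have := nth_find point (sP x); have := nth_find point (sP y).
rewrite -xy => /asboolP py /asboolP px.
have := ball_triangle (ball_sym px) py.
by rewrite -splitr ballEmdist.
Qed.

(* The code at level k is the lexicographic rank of the word of length k+1 whose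
   letters are the labels of x in k+1 successive finite partitions. *)
Lemma nested_codes : exists (c : nat -> X -> nat) (V : nat -> nat),
  [/\ forall k x, (c k x < V k)%N,
      forall k x y, (c k x < c k y)%N -> (c k.+1 x < c k.+1 y)%N &
      forall k x y, c k x = c k y -> mdist x y < k.+1%:R^-1].
Proof.
have /choice[Mf MfP] : forall k : nat, exists Mf : nat * (X -> nat),
    (forall x, (Mf.2 x < Mf.1)%N) /\
    forall x y, Mf.2 x = Mf.2 y -> mdist x y < (k.+1%:R^-1 : R).
  move=> k; have [|M [f fP]] := @finite_labelling k.+1%:R^-1.
    by rewrite invr_gt0.
  by exists (M, f).
pose c := fix c k x := if k is i.+1 then (c i x * (Mf k).1 + (Mf k).2 x)%N
  else (Mf 0%N).2 x.
pose V := fix V k := if k is i.+1 then (V i * (Mf k).1)%N else (Mf 0%N).1.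
exists c, V; split=> [|k x y /= cxy|[|k] x y /= cxy].
- elim=> [|k IH] x /=; first exact: (MfP 0%N).1.
  by have := (MfP k.+1).1 x; have := IH x; nia.
- by have := (MfP k.+1).1 x; nia.
- exact: (MfP 0%N).2.
(* The last letter of the word is the remainder of the code modulo the number of labels. *)
- apply: (MfP k.+1).2; have := congr1 (modn^~ (Mf k.+1).1) cxy.
  by rewrite !modnMDl !modn_small ?(MfP k.+1).1.
Qed.

End codes.

(** * Lebesgue measure on the unit interval *)

Section unit_interval_probability.
Context {R : realType}.

Definition unit_lebesgue :=
  mrestr (@lebesgue_measure R) (measurable_itv (`[(0:R), 1[ : interval R)).

HB.instance Definition _ := Measure.on unit_lebesgue.

Let unit_lebesgue_setT : unit_lebesgue setT = 1%E.
Proof. by rewrite /unit_lebesgue /mrestr setTI lebesgue_measure_itv/= lte01 sube0. Qed.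

HB.instance Definition _ :=
  Measure_isProbability.Build _ _ _ unit_lebesgue unit_lebesgue_setT.

Lemma unit_lebesgueE (a b : R) (A : set R) : 0 <= a -> a <= b -> b <= 1 ->
  A `&` `[0, 1[%classic = `[a, b[%classic -> unit_lebesgue A = (b - a)%:E.
Proof.
move=> a0 ab b1 AE; rewrite /unit_lebesgue /mrestr AE lebesgue_measure_itv/= lte_fin.
by case: ltP => // ba; rewrite (_ : b = a) ?subrr//; apply/le_anti/andP.
Qed.

(** Changes the parameter only on a null set for [unit_lebesgue], so that the quantile map can be
    defined at every real. *)
Definition unit_clamp (t : R) : R := if (0 <= t) && (t < 1) then t else 0.

Lemma unit_clamp_itv t : 0 <= unit_clamp t < 1.
Proof. by rewrite /unit_clamp; case: ifP => // _; rewrite lexx ltr01. Qed.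

Lemma measurable_unit_clamp : measurable_fun [set: R] unit_clamp.
Proof.
apply: measurable_fun_ifT => //; apply: measurable_and.
  by apply: measurable_fun_ler.
by apply: measurable_fun_ltr.
Qed.

End unit_interval_probability.

Lemma Rintegral_simple d (Y : measurableType d) (R : realType)
    (P : probability Y R) n (a : nat -> R) (A : nat -> set Y) :
  (forall v, measurable (A v)) ->
  P.-integrable [set: Y] (EFin \o (fun t => \sum_(v < n) a v * \1_(A v) t)) /\
  Rintegral P [set: Y] (fun t => \sum_(v < n) a v * \1_(A v) t) =
  \sum_(v < n) a v * fine (P (A v)).
Proof.
move=> mA; elim: n => [|n [IH1 IH2]].
  split; last first.
    rewrite big_ord0 -[RHS](prob_Rintegral_cst P).
    by apply: eq_Rintegral => x _; rewrite big_ord0.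
  apply: (eq_integrable measurableT (cst 0%E)) => //; last exact: integrable0.
  by move=> x _ /=; rewrite big_ord0.
have iA : P.-integrable [set: Y] (EFin \o (fun t => \1_(A n) t)).
  exact: integrable_indic.
have iaA : P.-integrable [set: Y] (EFin \o (fun t => a n * \1_(A n) t)).
  by apply: eq_integrable (integrableZl measurableT (a n) iA).
have SE : (fun t => \sum_(v < n.+1) a v * \1_(A v) t) =
    (fun t => \sum_(v < n) a v * \1_(A v) t + a n * \1_(A n) t).
  by apply/funext => t; rewrite big_ord_recr.
rewrite SE; split; first by apply: eq_integrable (integrableD measurableT IH1 iaA).
rewrite RintegralD// IH2 big_ord_recr/= RintegralZl//; congr (_ + _ * _).
by rewrite /Rintegral integral_indic// setIT.
Qed.

(** * A measure with prescribed masses of cells *)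

Section representation.
Context {R : realType} {X : pmetricType R}.
Hypothesis cptX : compact [set: X].
Variables (c : nat -> X -> nat) (V : nat -> nat) (G : nat -> nat -> R).
Hypothesis c_V : forall k x, (c k x < V k)%N.
Hypothesis c_S : forall k x y, (c k x < c k y)%N -> (c k.+1 x < c k.+1 y)%N.
Hypothesis c_dist : forall k x y, c k x = c k y -> mdist x y < k.+1%:R^-1.
Hypotheses (G_0 : forall k, G k 0%N = 0) (G_V : forall k, G k (V k) = 1).
(** [G k v] is the intended mass of the points whose code at level [k] is below [v]. Stated across
    levels, monotonicity yields the order in [v], the compatibility of the partitions, and zero mass
    for empty cells. *)
Hypothesis G_mono : forall k v k' v',
  (forall x, (c k x < v)%N -> (c k' x < v')%N) -> G k v <= G k' v'.

Definition cell_point k v : X := xget point [set x | c k x = v].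

(** The quantile map at level [k]: [t] in [[0, 1[] goes to the code [v] whose interval [[G k v, G k
    v.+1[] contains it. *)
Let cell k (t : R) : nat := find (fun v => t < G k v.+1) (iota 0 (V k)).
Let Zk k t := cell_point k (cell k t).

Let G_nd k v v' : (v <= v')%N -> G k v <= G k v'.
Proof. by move=> vv'; apply: G_mono => x /leq_trans; apply. Qed.

Let cellP k t : 0 <= t < 1 -> G k (cell k t) <= t < G k (cell k t).+1.
Proof.
move=> /andP[t0 t1]; rewrite /cell; set p := (fun v => _).
have hp : has p (iota 0 (V k)).
  apply/hasP; exists (V k).-1; last first.
    by rewrite /p prednK ?G_V//; apply: leq_ltn_trans (c_V k point).
  by rewrite mem_iota/= add0n prednK//; apply: leq_ltn_trans (c_V k point).
have fV : (find p (iota 0 (V k)) < V k)%N by move: hp; rewrite has_find size_iota.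
have := nth_find 0%N hp; rewrite nth_iota// add0n => ptf.
apply/andP; split; last exact: ptf.
case E : (find p (iota 0 (V k))) fV => [|v] fV; first by rewrite G_0.
have /(before_find 0%N) : (v < find p (iota 0 (V k)))%N by rewrite E.
rewrite nth_iota; last exact: ltnW.
by rewrite add0n /p => /negbT; rewrite -leNgt.
Qed.

Let cell_uniq k t v : 0 <= t < 1 -> G k v <= t < G k v.+1 -> cell k t = v.
Proof.
move=> /(@cellP k)/andP[c1 c2] /andP[v1 v2]; apply/eqP; rewrite eqn_leq.
apply/andP; split; rewrite leqNgt; apply/negP => h.
  by have := lt_le_trans v2 (le_trans (G_nd k h) c1); rewrite ltxx.
by have := lt_le_trans c2 (le_trans (G_nd k h) v1); rewrite ltxx.
Qed.

(** An empty cell has an empty interval by [G_mono], so the cell of [t] is inhabited and its chosen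
    point is genuine, not the default. *)
Let cell_pointP k t : 0 <= t < 1 -> c k (Zk k t) = cell k t.
Proof.
move=> /(@cellP k)/andP[c1 c2]; apply: (@xgetPex _ point [set x | c k x = cell k t]).
apply: contrapT => nex.
have Gle : G k (cell k t).+1 <= G k (cell k t).
  apply: G_mono => x; rewrite ltnS leq_eqVlt => /predU1P[xE|//].
  by exfalso; apply: nex; exists x.
by have := lt_le_trans (le_lt_trans c1 c2) Gle; rewrite ltxx.
Qed.

Let c_le j k x y : (j <= k)%N -> (c j x < c j y)%N -> (c k x < c k y)%N.
Proof.
by move=> /subnK <-; elim: (k - j)%N => // i IH /IH; rewrite addSn; exact: c_S.
Qed.

(** Codes refine in an order-preserving way, so the interval of [t] at level [k] lies inside the
    level-[j] interval given by the code of its representative. *)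
Let Zk_cell j k t : 0 <= t < 1 -> (j <= k)%N -> c j (Zk k t) = cell j t.
Proof.
move=> t01 jk; apply/esym/cell_uniq => //; have /andP[c1 c2] := cellP k t01.
rewrite -(cell_pointP k t01) in c1 c2; apply/andP; split.
  by apply: le_trans c1; apply: G_mono => x; exact: c_le.
apply: lt_le_trans c2 _; apply: G_mono => x; rewrite !ltnS leqNgt => cx.
by rewrite leqNgt; apply: contra cx; exact: c_le.
Qed.

(** From level [j] on, the representatives stay in the level-[j] cell of [t], whose points are less
    than [1 / j.+1] apart; any cluster point serves. *)
Let Z_ex t : 0 <= t < 1 -> exists z, forall j, mdist (Zk j t) z <= j.+1%:R^-1.
Proof.
move=> t01.
have [z [_ zcl]] := cptX (fmap_proper_filter (Zk ^~ t) eventually_filter) filterT.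
exists z => j; rewrite leNgt; apply/negP => jz.
set r := mdist (Zk j t) z - j.+1%:R^-1; have r0 : 0 < r by rewrite subr_gt0.
have nF : ((Zk ^~ t) @ \oo) [set y | mdist (Zk j t) y < j.+1%:R^-1].
  exists j => // k /= jk; apply: c_dist.
  by rewrite (cell_pointP j t01) (Zk_cell t01 jk).
have [y /= [jy]] := zcl _ _ nF (nbhsx_ballx z r r0); rewrite ballEmdist/= => zy.
have := le_lt_trans (metric_triangle (Zk j t) y z) (ltrD jy _).
rewrite metric_sym in zy; move=> /(_ r zy).
by rewrite /r addrC subrK ltxx.
Qed.

(* Skorokhod representation: a random point Z of X, defined on the unit
   interval, which falls in the cell of code v at level k when the parameter
   lies in [G k v, G k (v+1)[. *)
Lemma cell_measure : exists nu : probability (@Borel R X) R,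
  forall (g : X -> R) k e, continuous g ->
    (forall x y, mdist x y <= k.+1%:R^-1 -> `|g x - g y| <= e) ->
  `|Rintegral nu [set: @Borel R X] g -
    \sum_(v < V k) g (cell_point k v) * (G k v.+1 - G k v)| <= e.
Proof.
have /choice[Z ZP] : forall t : R, exists z, forall j,
    mdist (Zk j (unit_clamp t)) z <= j.+1%:R^-1.
  by move=> t; exact/Z_ex/unit_clamp_itv.
pose A k v := unit_clamp @^-1` `[G k v, G k v.+1[%classic.
have mA k v : measurable (A k v : set (measurableTypeR R)).
  rewrite -[A k v]setTI; exact: measurable_unit_clamp.
have AP k v t : A k v t <-> cell k (unit_clamp t) = v.
  rewrite /A /= in_itv/=; split; first exact: cell_uniq (unit_clamp_itv t).
  by move=> <-; exact: cellP (unit_clamp_itv t).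
have mZ : measurable_fun [set: measurableTypeR R]
    (Z : measurableTypeR R -> @Borel R X).
  apply: (@measurability _ _ (measurableTypeR R) (@Borel R X) setT Z (@open X) erefl).
  move=> _ [W oW <-]; rewrite setTI.
  (* The preimage of [W] is a countable union of cells whose representative has its ball of radius
     [2 / k.+1] inside [W]. Since [Z t] is within [1 / k.+1] of its representative, a level with
     [3 / k.+1 < r] catches each [t] whose [r]-ball around [Z t] lies in [W]. *)
  rewrite (_ : Z @^-1` W = \bigcup_k \bigcup_(v in
      [set v | ball (cell_point k v) (2 * k.+1%:R^-1) `<=` W]) A k v).
    apply: bigcupT_measurable => k; apply: bigcup_measurable => v _; exact: mA.
  apply/seteqP; split=> [t /= Wt|t [k _ [v /= vW /AP tv]]]; last first.
    apply: vW; rewrite -tv ballEmdist/=; apply: le_lt_trans (ZP t k) _.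
    by rewrite ltr_pMl ?invr_gt0// ltr1n.
  have /nbhs_ballP[r /= r0 rW] : nbhs (Z t) W by apply: open_nbhs_nbhs.
  have [k kr] : exists k : nat, (3 * k.+1%:R^-1 : R) < r.
    have r30 : 0 < r / 3 by rewrite divr_gt0.
    have [k _ /(_ k (leqnn _)) /= kP] := near_infty_natSinv_lt (PosNum r30).
    by exists k; rewrite mulrC -ltr_pdivlMr.
  exists k; first by []. exists (cell k (unit_clamp t)); last by apply/AP.
  move=> y /=; rewrite ballEmdist/= => yk; apply: rW; rewrite ballEmdist/=.
  apply: le_lt_trans (metric_triangle _ (Zk k (unit_clamp t)) _) _.
  apply: lt_trans kr; have := ZP t k; rewrite metric_sym => Ztk.
  have : mdist (Zk k (unit_clamp t)) y < 2 * k.+1%:R^-1 by [].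
  move: Ztk; set a := mdist _ _; set b := mdist _ _; set s := _^-1; lra.
pose mfZ : {mfun measurableTypeR R >-> @Borel R X} :=
  HB.pack (Z : measurableTypeR R -> @Borel R X) (isMeasurableFun.Build _ _ _ _ _ mZ).
pose P : probability (measurableTypeR R) R := @unit_lebesgue R.
exists (distribution P mfZ) => g k e cg ge.
have [M M0 gM] := continuous_bounded cptX cg.
have mg := continuous_Borel_measurable cg.
have mgZ : measurable_fun [set: measurableTypeR R] (g \o Z).
  by exact: (measurableT_comp mg mZ).
have igZ : P.-integrable [set: measurableTypeR R] (EFin \o (g \o Z)).
  by apply: (@prob_bounded_integrable _ _ _ P (g \o Z) M mgZ) => t; exact: gM.
have -> : Rintegral (distribution P mfZ) [set: @Borel R X] g =
    Rintegral P [set: measurableTypeR R] (g \o Z).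
  rewrite /Rintegral; congr fine.
  have igZ' : P.-integrable (Z @^-1` [set: @Borel R X]) (EFin \o (g \o Z)).
    by rewrite preimage_setT.
  rewrite (integral_pushforward mZ _ igZ')// ?preimage_setT//.
  exact/measurable_EFinP.
have [iS sE] := Rintegral_simple P (V k) (fun v => g (cell_point k v)) (mA k).
have -> : \sum_(v < V k) g (cell_point k v) * (G k v.+1 - G k v) =
    \sum_(v < V k) g (cell_point k v) * fine (P (A k v)).
  apply: eq_bigr => v _; congr (_ * _).
  have a0 : 0 <= G k v by rewrite -(G_0 k) G_nd.
  have b1 : G k v.+1 <= 1 by rewrite -(G_V k) G_nd.
  rewrite [P _](@unit_lebesgueE _ (G k v) (G k v.+1))//; first exact: G_nd.
  apply/seteqP; split => t; rewrite /A /= !in_itv/= /unit_clamp.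
    by move=> [+ /andP[t0 t1]]; rewrite t0 t1.
  move=> /andP[t0 t1]; rewrite (le_trans a0 t0) (lt_le_trans t1 b1)/=.
  by rewrite t0 t1.
rewrite -sE; apply: prob_Rintegral_dist => // t.
have -> : \sum_(v < V k) g (cell_point k v) * \1_(A k v) t = g (Zk k (unit_clamp t)).
  have t01 := unit_clamp_itv t.
  have cV : (cell k (unit_clamp t) < V k)%N by rewrite -(cell_pointP k t01).
  rewrite (bigD1 (Ordinal cV))//= indicE mem_set ?mulr1; last exact/AP.
  rewrite big1 ?addr0// => v; rewrite -val_eqE/= => vt.
  by rewrite indicE memNset ?mulr0// => /AP tv; rewrite tv eqxx in vt.
by apply: ge; rewrite metric_sym; exact: ZP.
Qed.

End representation.

Section empirical_compactness.
Context {R : realType} {X : pmetricType R}.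
Variable T : X -> X.
Hypotheses (cptX : compact [set: X]) (cT : continuous T).

(** The frequencies of initial segments of codes form countably many bounded sequences; along a
    diagonal subsequence they converge to a [G] fit for [cell_measure]. As the indicators [chi] need
    not be continuous, weak convergence is checked through sums over cells. The set [A] lets the
    times be prescribed. *)
Lemma empirical_weak_compact (x : X) (A : nat -> Prop) : infinitely_often A ->
  exists (nu : probability (@Borel R X) R) (phi : nat -> nat),
    [/\ forall k, (phi k < phi k.+1)%N, forall k, A (phi k) &
        weak_cvg (fun k => empirical T x (phi k)) nu].
Proof.
move=> Aio; have [c [V [cV cS cd]]] := nested_codes cptX.
pose chi k v (z : X) : R := (c k z < v)%N%:R.
pose freq n k v : R := n%:R^-1 * birkhoff T (chi k v) n x.
have chi1 k v z : `|chi k v z| <= 1.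
  by rewrite /chi ger0_norm// lern1 leq_b1.
(* Pairs [(k, v)] are enumerated by [pickle]; an integer that codes no pair gets the harmless
   default [(0, 0)]. *)
pose q j n := let kv := odflt (0, 0)%N (unpickle j : option (nat * nat)) in
  freq n kv.1 kv.2.
have q1 j n : `|q j n| <= 1.
  rewrite /q /freq normrM ger0_norm ?invr_ge0//.
  have [->|n0] := posnP n; first by rewrite invr0 mul0r.
  rewrite mulrC ler_pdivrMr ?ltr0n// mul1r -[leRHS]mulr1.
  exact: birkhoff_bound.
have [phi [l [phiS Aphi ql]]] := bounded_diagonal Aio q1.
have phi_ge k : (k <= phi k)%N.
  by elim: k => // k IH; apply: leq_ltn_trans IH (phiS k).
pose G (k v : nat) : R := l (pickle (k, v)).
have fG k v : (fun n => freq (phi n) k v) @ \oo --> G k v.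
  by have := ql (pickle (k, v)); rewrite /q pickleK.
have G_0 k : G k 0%N = 0.
  rewrite -(cvg_lim (@Rhausdorff R) (fG k 0%N)); apply: cvg_lim => //.
  apply: cvg_near_cst; apply: nearW => n; rewrite /freq /birkhoff big1 ?mulr0//.
have G_V k : G k (V k) = 1.
  rewrite -(cvg_lim (@Rhausdorff R) (fG k (V k))); apply: cvg_lim => //.
  apply: cvg_near_cst; near=> n; rewrite /freq /birkhoff.
  have n0 : (0 < phi n)%N.
    by apply: leq_trans (phi_ge n); near: n; exact: nbhs_infty_gt.
  under eq_bigr do rewrite /chi cV.
  by rewrite sumr_const card_ord mulVf// pnatr_eq0 -lt0n.
have G_mono k v k' v' : (forall z, (c k z < v)%N -> (c k' z < v')%N) ->
    G k v <= G k' v'.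
  move=> sub; apply: ler_cvg_to (fG k v) (fG k' v') _; apply: nearW => n.
  rewrite /freq ler_wpM2l ?invr_ge0// /birkhoff ler_sum// => i _.
  by rewrite /chi ler_nat; case: (ltnP (c k _) v) => // /sub ->.
have [nu nuP] := cell_measure cptX cV cS cd G_0 G_V G_mono.
exists nu, phi; split => //.
apply: (proj2 (weak_cvg_empirical T cptX nu x phi)) => g cg.
apply/cvgrPdist_lt => e e0.
have e30 : 0 < e / 3 by rewrite divr_gt0.
have [d d0 dP] := continuous_uniform cptX cg e30.
have [k _ /(_ k (leqnn _)) /= kd] := near_infty_natSinv_lt (PosNum d0).
have gk y z : mdist y z <= k.+1%:R^-1 -> `|g y - g z| <= e / 3.
  by move=> yz; apply/ltW/dP/(le_lt_trans yz).
pose p := cell_point c k.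
(* [S n] is the empirical average of [g] rounded to the representatives of cells ([SE]). It is close
   to the true average, and converges as a finite combination of frequencies. *)
pose S n := \sum_(v < V k) g (p v) * (freq n k v.+1 - freq n k v).
have cS' : (fun n => S (phi n)) @ \oo -->
    \sum_(v < V k) g (p v) * (G k v.+1 - G k v).
  rewrite /S; elim: (V k) => [|m IH].
    under eq_fun do rewrite big_ord0.
    by rewrite big_ord0; exact: cvg_cst.
  under eq_fun do rewrite big_ord_recr/=.
  rewrite big_ord_recr/=; apply: cvgD IH _; apply: cvgM; first exact: cvg_cst.
  exact: cvgB (fG _ _) (fG _ _).
have SE n : S n = n%:R^-1 * birkhoff T (fun z => g (p (c k z))) n x.
  rewrite /S /freq; under eq_bigr do rewrite -mulrBr mulrCA.
  rewrite -mulr_sumr; congr (_ * _); rewrite /birkhoff.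
  under eq_bigr do rewrite -sumrB mulr_sumr.
  rewrite exchange_big/=; apply: eq_bigr => i _; set z := iter i T x.
  rewrite (bigD1 (Ordinal (cV k z)))//= /chi ltnSn ltnn subr0 mulr1.
  rewrite big1 ?addr0// => v; rewrite -val_eqE/= ltnS leq_eqVlt eq_sym => /negPf ->.
  by rewrite subrr mulr0.
have Sg n : `|S n - n%:R^-1 * birkhoff T g n x| <= e / 3.
  have [->|n0] := posnP n.
    by rewrite SE invr0 !mul0r subrr normr0 ltW.
  rewrite SE -mulrBr normrM ger0_norm ?invr_ge0// ler_pdivrMl ?ltr0n//.
  rewrite /birkhoff -sumrB (le_trans (ler_norm_sum _ _ _))//.
  apply: (@le_trans _ _ (\sum_(i < n) e / 3)); last first.
    by rewrite sumr_const card_ord mulr_natl.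
  apply: ler_sum => i _; apply/gk/ltW/cd.
  exact: (@xgetPex _ point [set y | c k y = c k (iter i T x)]
    (ex_intro _ (iter i T x) erefl)).
near=> n.
have := nuP g k (e / 3) cg gk.
have := Sg (phi n).
have : `|\sum_(v < V k) g (p v) * (G k v.+1 - G k v) - S (phi n)| < e / 3.
  by near: n; move/cvgrPdist_lt : cS'; exact.
rewrite /p; set a := \sum_(v < _) _; set b := S _; set I := Rintegral _ _ _.
set w := _^-1 * _.
rewrite !ltr_norml !ler_norml => /andP[? ?] /andP[? ?] /andP[? ?].
by apply/andP; split; lra.
Unshelve. all: by end_near. Qed.

End empirical_compactness.

(** * The variational principle on the irregular set *)

Lemma lee_EFin_lt {R : realType} (x y : \bar R) :
  (forall c : R, (c%:E < x)%E -> (c%:E <= y)%E) -> (x <= y)%E.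
Proof.
case: x => [r||] H; last by rewrite leNye.
- apply/lee_subgt0Pr => e e0; rewrite -EFinB; apply: H.
  by rewrite lte_fin ltrBlDr ltrDl.
- rewrite leye_eq; apply/eqP/eqyP => A _; apply: H; exact: ltry.
Qed.

Section variational.
Context {R : realType} {X : pmetricType R}.
Variables (T : X -> X) (F Phi : nat -> X -> R).
Hypotheses (cptX : compact [set: X]) (cT : continuous T).
Hypotheses (aapF : AAP T F) (aapPhi : AAP T Phi).

(** The subsequence is extracted among the times at which the average of [F] exceeds [c], so the
    limit measure inherits the bound. *)
Lemma lt_limn_esup_Vset (x : X) (c : R) :
  (c%:E < limn_esup (fun n => (n%:R^-1 * F n x)%:E))%E ->
  exists2 nu, Vset T x nu & c <= Fstar F nu.
Proof.
move=> /lt_limn_esup_io/(empirical_weak_compact T cptX x)[nu [phi [phiS cF W]]].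
have Vnu : Vset T x nu by exists phi.
exists nu => //.
have phi_ge k : (k <= phi k)%N.
  by elim: k => // k IH; apply: leq_ltn_trans IH (phiS k).
apply/ler_addgt0Pr => e e0; have e20 : 0 < e / 2 by rewrite divr_gt0.
have [g cg Fg] := AAP_birkhoff cptX cT aapF e20.
have := AAP_Fstar cptX cT aapF (Vset_invariant cptX cT Vnu) cg Fg.
suff : c - e / 2 <= Rintegral nu [set: @Borel R X] g.
  by rewrite ler_norml => ? /andP[? ?]; lra.
have [W' _] := weak_cvg_empirical T cptX nu x phi.
apply: (cvgr_to_ge (W' W g cg)).
have [N _ FgN] := Fg; near=> k.
have Nk : (N < phi k)%N.
  by apply: leq_trans (phi_ge k); near: k; exact: nbhs_infty_gt.
have k0 : 0 < (phi k)%:R :> R by rewrite ltr0n; lia.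
have := FgN _ (ltnW Nk) x; have := cF k.
rewrite lte_fin ltr_pdivlMl// ler_pdivlMl// ler_norml => cFk /andP[_ Fgk].
by move: cFk Fgk; rewrite mulrBr [e / 2 * _]mulrC; lra.
Unshelve. all: by end_near. Qed.

Lemma irregular_limsup (mu mu1 mu2 : probability (@Borel R X) R) (c : R) :
  specification T -> MT T mu -> MT T mu1 -> MT T mu2 ->
  Fstar Phi mu1 < Fstar Phi mu2 -> c < Fstar F mu ->
  exists2 x, irregular_set Phi x &
    (c%:E <= limn_esup (fun n => (n%:R^-1 * F n x)%:E))%E.
Proof.
move=> spec Tmu Tmu1 Tmu2 lt12 ltc.
set s1 := Fstar Phi mu1 in lt12; set s2 := Fstar Phi mu2 in lt12.
set sF := Fstar F mu in ltc.
(* Each bound loses four units: potential versus integral of the approximant, strictness in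
   [MT_point_above], shadowing, and approximant versus potential along the orbit. For [F] this uses
   up [sF - c]; for [Phi] the two sides lose [8 * h], and the remaining [4 * h] exceeds the [2 * h]
   allowed by convergence. *)
pose e := (sF - c) / 4; pose h := (s2 - s1) / 12.
have e0 : 0 < e by rewrite divr_gt0// subr_gt0.
have h0 : 0 < h by rewrite divr_gt0// subr_gt0.
have [gF cgF FgF] := AAP_birkhoff cptX cT aapF e0.
have [gP cgP PgP] := AAP_birkhoff cptX cT aapPhi h0.
have cgN : continuous (\- gP) by move=> y; apply: cvgN; exact: cgP.
have := AAP_Fstar cptX cT aapF Tmu cgF FgF.
have := AAP_Fstar cptX cT aapPhi Tmu1 cgP PgP.
have := AAP_Fstar cptX cT aapPhi Tmu2 cgP PgP.
rewrite -/s1 -/s2 -/sF !ler_norml => /andP[_ I2] /andP[I1 _] /andP[_ IF].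
have [y yF] : exists y, infinitely_often
    (fun n => (sF - 2 * e) * n%:R <= birkhoff T gF n y).
  by apply: (MT_point_above cptX cT Tmu cgF); lra.
have [w wP] : exists y, infinitely_often
    (fun n => (s2 - 2 * h) * n%:R <= birkhoff T gP n y).
  by apply: (MT_point_above cptX cT Tmu2 cgP); lra.
(* Low averages of [gP] are high averages of its opposite, so the same lemma applies. *)
have [u uP] : exists y, infinitely_often
    (fun n => - (s1 + 2 * h) * n%:R <= birkhoff T (\- gP) n y).
  apply: (MT_point_above cptX cT Tmu1 cgN).
  have -> : Rintegral mu1 [set: @Borel R X] (\- gP) =
      - Rintegral mu1 [set: @Borel R X] gP.
    rewrite -mulN1r -RintegralZl//; last exact: continuous_integrable.
    by apply: eq_Rintegral => z _; rewrite mulN1r.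
  by lra.
pose pts i := nth u [:: u; w; y] i.
pose fs i := nth gF [:: \- gP; gP; gF] i.
pose cs i := nth 0 [:: - (s1 + 2 * h); s2 - 2 * h; sF - 2 * e] i.
have cfs i : continuous (fs i).
  by rewrite /fs; case: i => [|[|[|i]]] //=; rewrite nth_nil.
have d0 : 0 < Num.min e h by rewrite lt_min e0.
have [|x xP] := shadow_birkhoff cptX cT spec (k := 3) (u := pts) (c := cs) cfs d0.
  by move=> [|[|[|i]]].
have de : Num.min e h <= e by rewrite ge_min lexx.
have dh : Num.min e h <= h by rewrite ge_min lexx orbT.
move: (Num.min e h) d0 de dh xP => d d0 de dh xP.
have pos n : (0 < n)%N -> 0 < n%:R :> R by rewrite ltr0n.
have near_gt0 : \forall n \near \oo, (0 < n)%N by exact: nbhs_infty_gt.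
have lowP : infinitely_often (fun n => n%:R^-1 * Phi n x <= s1 + 4 * h).
  have := near_infinitely_often near_gt0 (near_infinitely_often PgP (xP 0%N isT)).
  apply: sub_infinitely_often => n [[]]; rewrite /cs /fs /= birkhoffN.
  move=> Hn /(_ x); rewrite ler_norml => /andP[_ Pn] /pos n0.
  rewrite ler_pdivrMl//; nra.
have highP : infinitely_often (fun n => s2 - 4 * h <= n%:R^-1 * Phi n x).
  have := near_infinitely_often near_gt0 (near_infinitely_often PgP (xP 1%N isT)).
  apply: sub_infinitely_often => n [[]]; rewrite /cs /fs /=.
  move=> Hn /(_ x); rewrite ler_norml => /andP[Pn _] /pos n0.
  rewrite ler_pdivlMl//; nra.
exists x.
  move=> /cvg_ex[l /cvgrPdist_lt/(_ h h0) nl].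
  have [n _ [Hn]] := near_infinitely_often nl lowP 0%N.
  have [m _ [Hm]] := near_infinitely_often nl highP 0%N.
  rewrite !ltr_norml => /andP[? ?] /andP[? ?].
  have : 12 * h = s2 - s1 by rewrite mulrC divfK.
  move: Hn Hm; lra.
apply: io_le_limn_esup.
have := near_infinitely_often near_gt0 (near_infinitely_often FgF (xP 2%N isT)).
apply: sub_infinitely_often => n [[]]; rewrite /cs /fs /=.
move=> Hn /(_ x); rewrite ler_norml => /andP[Fn _] /pos n0.
have cE : c = sF - 4 * e by rewrite /e mulrC divfK// subKr.
rewrite lee_fin ler_pdivlMl// cE; nra.
Qed.

End variational.

Theorem theoremD (R : realType) (X : pmetricType R) (T : X -> X)
    (F Phi : nat -> X -> R) :
  compact [set: X] -> continuous T -> specification T ->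
  AAP T F -> AAP T Phi -> (eta_pot T Phi < beta_pot T Phi)%E ->
  beta_pot T F = ereal_sup [set limn_esup (fun n : nat => ((n%:R)^-1 * F n x)%:E)
                        | x in irregular_set Phi] /\
  beta_pot T F = ereal_sup [set (Fstar F mu)%:E
                        | mu in \bigcup_(x in irregular_set Phi) Vset T x].
Proof.
move=> cptX cT spec aapF aapPhi.
(* The gap between [eta_pot] and [beta_pot] supplies the two invariant measures that separate
   [Phi]. *)
move=> /ereal_inf_lt[_ [mu1 Tmu1 <-]] /ereal_sup_gt[_ [mu2 Tmu2 <-]].
rewrite lte_fin => lt12.
set S1 := (X in _ = X /\ _); set S2 := (X in _ /\ _ = X).
have BS1 : (beta_pot T F <= S1)%E.
  apply: ge_ereal_sup => _ [mu Tmu <-]; apply: lee_EFin_lt => c.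
  rewrite lte_fin => ltc.
  have [x ix cx] := irregular_limsup cptX cT aapF aapPhi spec Tmu Tmu1 Tmu2 lt12 ltc.
  by apply: le_trans cx _; apply: ereal_sup_ubound; exists x.
have S12 : (S1 <= S2)%E.
  apply: ge_ereal_sup => _ [x ix <-]; apply: lee_EFin_lt => c.
  move=> /(lt_limn_esup_Vset cptX cT aapF)[nu xnu cnu].
  apply: (@le_trans _ _ (Fstar F nu)%:E); first by rewrite lee_fin.
  by apply: ereal_sup_ubound; exists nu => //; exists x.
have S2B : (S2 <= beta_pot T F)%E.
  apply: ge_ereal_sup => _ [nu [x ix xnu] <-]; apply: ereal_sup_ubound.
  by exists nu; first exact: (Vset_invariant cptX cT xnu).
by split; apply/eqP; rewrite eq_le; apply/andP; split;
  [|exact: le_trans S2B|exact: le_trans S12|].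
Qed.
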